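(* For each $n\ge1$ let $\mathbf d=\mathbf d_n=(d_1,\dots,d_n)$, $d_i=d_i^{(n)}$, be a sequence of nonnegative integers with even sum. Assume that, as $n\to\infty$, $\sum_{i=1}^n d_i=\Theta(n)$ and $\sum_{i=1}^n d_i^2=O(n)$. Consider the switching process constructing the switched configuration model $\widehat G(n,\mathbf d)$ (with an arbitrary fixed rule for choosing which bad edge to switch), and let $S\in\{0,1,2,\dots\}\cup\{\infty\}$ be the number of switchings performed before it terminates. Then, with probability tending to $1$ as $n\to\infty$, no new bad edges are created during the process, and the process terminates after $O_{\mathrm p}(1)$ switchings, i.e. $$\lim_{K\to\infty}\limsup_{n\to\infty}\mathbb P(S>K)=0 .$$
   Context: $\Theta(n)$ means a quantity in $[cn,Cn]$ for some constants $c,C>0$ not depending on $n$. $N:=\sum_i d_i$. Configuration model: assign $d_i$ half-edges $i_1,\dots,i_{d_i}$ to each vertex $i\in[n]=\{1,\dots,n\}$, for a total of $N$ half-edges. A configuration is a perfect matching of the half-edges; it projects to a multigraph on $[n]$ by regarding each matched pair $\{i_\alpha,j_\beta\}$ as an edge between $i$ and $j$ (a loop if $i=j$). Let $\Gamma_0$ be a uniformly random configuration. Switching process: an edge (matched pair) of a configuration is bad if it is a loop or is parallel to another edge. Starting from $\Gamma_0$, as long as the current configuration $\Gamma_{k-1}$ ($k\ge1$) has a bad edge, choose a bad edge $i_\alpha j_\beta$ by some fixed rule (e.g. the first in lexicographic order, or a random one), choose another edge $k_\gamma\ell_\delta$ uniformly at random among all other edges of $\Gamma_{k-1}$, order its two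 half-edges $k_\gamma,\ell_\delta$ uniformly at random, and replace the two edges $i_\alpha j_\beta$, $k_\gamma\ell_\delta$ by $i_\alpha\ell_\delta$, $k_\gamma j_\beta$ (a switching), giving $\Gamma_k$. The process terminates when there are no bad edges; $\widehat G(n,\mathbf d)$ is the simple graph that the final configuration projects to. A new bad edge is created in the $k$th switching if some edge of $\Gamma_k$ is bad in $\Gamma_k$ and was not a bad edge of $\Gamma_{k-1}$. *)

(* Defs.v *)
From HB Require Import structures.
From mathcomp Require Import all_boot all_order all_algebra.
From mathcomp Require Import all_classical all_reals all_analysis.
Import Order.TTheory GRing.Theory Num.Theory.
Import numFieldNormedType.Exports.

Set Implicit Arguments.
Unset Strict Implicit.
Unset Printing Implicit Defensive.

Local Open Scope ring_scope.

Section Configurations.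
Local Open Scope nat_scope.
Local Open Scope set_scope.
Variables (n : nat) (d : 'I_n -> nat).

(* Half-edges are the dependent pairs (i, alpha) with alpha < d i; the vertex
   carrying a half-edge h is tag h. *)
Definition half_edge : finType := {i : 'I_n & 'I_(d i)}.

Definition edge_set := {set {set half_edge}}.

(* The perfect matchings of the half-edges. *)
Definition configurations : {set edge_set} :=
  [set G : edge_set | finset.partition G [set: half_edge] &
     [forall e in G, #|e| == 2]].

(* The end vertices of a matched pair; this set is a singleton for a loop. *)
Definition endpoints (e : {set half_edge}) : {set 'I_n} :=
  [set tag h | h in e].

Definition is_loop (e : {set half_edge}) : bool := #|endpoints e| == 1.

Definition parallel (e f : {set half_edge}) : bool :=
  (e != f) && (endpoints e == endpoints f).

Definition bad_edges (G : edge_set) : {set {set half_edge}} :=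
  [set e in G | is_loop e || [exists f in G, parallel e f]].

Definition has_bad_edge (G : edge_set) : bool := bad_edges G != finset.set0.

Definition creates_bad_edge (G G' : edge_set) : bool :=
  ~~ (bad_edges G' \subset bad_edges G).

(* With p = (i_alpha, j_beta) and q = (k_gamma, l_delta), the edges
   i_alpha j_beta and k_gamma l_delta become i_alpha l_delta and
   k_gamma j_beta. *)
Definition switch (G : edge_set) (p q : half_edge * half_edge) : edge_set :=
  (G :\: [set [set p.1; p.2]; [set q.1; q.2]])
    :|: [set [set p.1; q.2]; [set q.1; p.2]].

End Configurations.

Section SwitchingProcess.
Variables (R : realType) (n : nat) (d : 'I_n -> nat).

(* A possibly randomized rule for choosing the bad edge to be switched, written
   as an ordered pair of half-edges: [rule s p] is the probability of choosing p
   when s lists the successive configurations so far, the current one last. *)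
Definition bad_edge_rule
    (rule : seq (edge_set d) -> half_edge d * half_edge d -> R) : Prop :=
  forall (s : seq (edge_set d)) (G : edge_set d),
    {subset rcons s G <= configurations d} -> has_bad_edge G ->
    [/\ forall p, 0 <= rule (rcons s G) p,
        \sum_p rule (rcons s G) p = 1
      & forall p, rule (rcons s G) p != 0 ->
          [set p.1; p.2]%SET \in bad_edges G].

(* The probability of passing from G to G' in one switching, when [choice] is
   the law of the bad edge p to be switched: f is uniform among the edges of G
   other than p, and q is one of the two orderings of f. *)
Definition switching_prob (choice : half_edge d * half_edge d -> R)
    (G G' : edge_set d) : R :=
  \sum_p choice p *
    \sum_(f in (G :\ [set p.1; p.2])%SET)
      (#|(G :\ [set p.1; p.2])%SET|%:R)^-1 *
      \sum_(q | [set q.1; q.2]%SET == f) 2^-1 * (switch G p q == G')%:R.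

(* After termination the configuration is repeated forever.  It is also
   repeated forever when its only edge is bad: there is no other edge to switch
   it with, and the process never terminates. *)
Definition transition_prob (choice : half_edge d * half_edge d -> R)
    (G G' : edge_set d) : R :=
  if has_bad_edge G && (1 < #|G|)%N
  then switching_prob choice G G'
  else (G' == G)%:R.

Variables (disp : measure_display) (T : measurableType disp).

Local Open Scope classical_set_scope.

(* The event that s lists the first [size s] configurations. *)
Definition history (Gamma : nat -> T -> edge_set d) (s : seq (edge_set d)) :
    set T :=
  [set w | mkseq (fun k => Gamma k w) (size s) = s].

Record switching_process (P : probability T R)
    (rule : seq (edge_set d) -> half_edge d * half_edge d -> R)
    (Gamma : nat -> T -> edge_set d) : Prop := SwitchingProcess {
  switching_process_measurable : forall k G,
    measurable [set w | Gamma k w = G];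
  switching_process_start : forall G,
    P [set w | Gamma 0%N w = G] =
      ((G \in configurations d)%:R / #|configurations d|%:R)%:E;
  switching_process_step : forall s G G',
    P (history Gamma (rcons (rcons s G) G')) =
      (P (history Gamma (rcons s G)) *
        (transition_prob (rule (rcons s G)) G G')%:E)%E }.

(* The least k such that Gamma k, the configuration after k switchings, has no
   bad edge; +oo if there is always a bad edge. *)
Definition switching_time (Gamma : nat -> T -> edge_set d) (w : T) : \bar R :=
  ereal_inf [set (k%:R)%:E | k in [set k | ~~ has_bad_edge (Gamma k w)]].

Definition no_new_bad_edge (Gamma : nat -> T -> edge_set d) : set T :=
  [set w | forall k : nat, ((k%:R)%:E < switching_time Gamma w)%E ->
     ~~ creates_bad_edge (Gamma k w) (Gamma k.+1 w)].

End SwitchingProcess.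

(* Main.v *)
Require Import Defs.
From HB Require Import structures.
From mathcomp Require Import all_boot all_order all_algebra.
From mathcomp Require Import fingroup perm.

(** Write N for the number of half-edges, M for the sum of the squared degrees
    and m for the maximal degree; thus N is of order n, M = O(n) and
    m = O(sqrt n).

    As long as no bad edge is created, every switching removes at least one bad
    edge, so the process stops after at most as many switchings as the initial
    configuration has bad edges.  The expected number of these is at most about
    M / N + (M / N)^2, which is bounded, and Markov's inequality makes the
    number of bad edges tight.  The whole theorem therefore reduces to showing
    that each of the first K switchings, K fixed, is unlikely to create a bad
    edge.

    If the bad edge ij is switched with the random edge kl, then il and kj
    appear.  One of them is bad, or makes an old edge bad, only if l = i,
    k = j, k = i, k = l, l is adjacent to i or k is adjacent to j
    ([creates_bad_edge_switch]).  Hence at most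
    3 m + 2 (number of bad edges) + D(i) + D(j) of the N - 2 oriented edges kl
    do harm, where D(i) is the sum of the degrees of the neighbours of i
    ([card_creating_choices]), and it remains to see that D(i) = o(n) for the
    vertices i that occur.  Bounding D(i) by d_i m only gives O(n).  Instead let
    Q be the sum over all vertices of d_i D(i), the [weight] of the
    configuration.  From D(i) <= d_i m and d_i D(i) <= Q it follows that
    D(i)^2 <= m Q ([neighbour_degrees_sqr]).  The expectation of Q is at most
    M^2 / (N - 1) = O(n) in the initial configuration
    ([sum_weight_configurations]), and a switching increases Q by at most
    4 m^2 = O(n) ([weight_switch]), whichever rule is used.  So during K
    switchings Q = O(n) with probability close to 1, and then
    D(i) = O(n^(3/4)).

    Only joint probabilities of one or two given edges enter.  They come from
    the invariance of the uniform law under permutations of the half-edges: all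
    possible mates of a half-edge are equally likely ([count_extensions1],
    [count_extensions2]).  [exceptional_bound] collects the estimates for a
    fixed n, and [eventually_unlikely] lets n tend to infinity. *)

Set Implicit Arguments.
Unset Strict Implicit.
Unset Printing Implicit Defensive.

(** * Sums and cardinals over finite types *)

Section FiniteSums.
Local Open Scope nat_scope.
Local Open Scope set_scope.

Lemma pair_set_eq (T : finType) (x y u v : T) :
  [set x; y] = [set u; v] -> (x = u /\ y = v) \/ (x = v /\ y = u).
Proof.
move=> /setP E; have := (E x, E y, E u, E v); rewrite !inE !eqxx ?orbT /=.
move=> [[[/esym/orP[]/eqP xE /esym/orP[]/eqP yE] /orP[]/eqP uE] /orP[]/eqP vE];
  by [left; split; congruence | right; split; congruence].
Qed.

Lemma card_sum_mem (I : finType) (A : pred I) : #|A| = \sum_i (i \in A).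
Proof. by rewrite -sum1_card big_mkcond; apply: eq_bigr => i _; case: (_ \in _). Qed.

Lemma leq_sum_or (I : finType) (P Q : pred I) (F : I -> nat) :
  \sum_(i | P i || Q i) F i <= \sum_(i | P i) F i + \sum_(i | Q i) F i.
Proof.
rewrite [leqLHS]big_mkcond [X in _ <= X + _]big_mkcond [X in _ <= _ + X]big_mkcond.
rewrite -big_split /=; apply: leq_sum => i _.
by case: (P i); case: (Q i); rewrite //= leq_addr.
Qed.

Lemma markov_nat (I : finType) (A : {set I}) (f : I -> nat) K :
  #|[set i in A | K < f i]| * K.+1 <= \sum_(i in A) f i.
Proof.
rewrite -sum_nat_const big_mkcond [leqRHS]big_mkcond.
by apply: leq_sum => i _; rewrite inE; case: (i \in A) => //=; case: ltnP.
Qed.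

End FiniteSums.

(** * Configurations *)

Section Configurations.
Local Open Scope nat_scope.
Local Open Scope set_scope.
Variables (n : nat) (d : 'I_n -> nat).
Implicit Types (G : edge_set d) (e f : {set half_edge d}) (h a b c : half_edge d).
Implicit Types p q : half_edge d * half_edge d.

Lemma sum_half_edge (F : 'I_n -> nat) :
  \sum_(h : half_edge d) F (tag h) = \sum_i d i * F i.
Proof.
rewrite -(sig_big_dep xpredT (fun _ _ => true) (fun i (_ : 'I_(d i)) => F i)).
by apply: eq_bigr => i _; rewrite sum_nat_const card_ord.
Qed.

Lemma card_half_edge : #|half_edge d| = \sum_i d i.
Proof.
rewrite -sum1_card (sum_half_edge (fun=> 1)).
by apply: eq_bigr => i _; rewrite muln1.
Qed.

Lemma card_half_edge_at i : #|[set h : half_edge d | tag h == i]| = d i.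
Proof.
rewrite -sum1dep_card big_mkcond (sum_half_edge (fun j => if j == i then 1 else 0)).
rewrite (bigD1 i) //= eqxx muln1 big1 ?addn0 // => j /negPf ->.
by rewrite muln0.
Qed.

Lemma configurationsP G :
  reflect [/\ forall e, e \in G -> #|e| = 2,
              forall e f h, e \in G -> f \in G -> h \in e -> h \in f -> e = f
            & forall h, exists2 e, e \in G & h \in e]
          (G \in configurations d).
Proof.
rewrite inE; apply: (iffP andP) => [[/and3P[/eqP cov /trivIsetP tI _] /forall_inP c2]|].
  split=> [e /c2/eqP //|e f h eG fG he hf|h].
    by apply: contraTeq he => /(tI e f eG fG)/disjointFl ->.
  have: h \in cover G by rewrite cov inE.
  by case/bigcupP=> e eG he; exists e.
case=> c2 uniq cov; split; last by apply/forall_inP => e /c2 ->.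
apply/and3P; split.
- apply/eqP/setP => h; rewrite inE; have [e eG he] := cov h.
  by apply/bigcupP; exists e.
- apply/trivIsetP => e f eG fG; apply: contraNT => /pred0Pn[h /andP[/= he hf]].
  by apply/eqP; apply: uniq he hf.
- by apply/negP => /c2; rewrite cards0.
Qed.

Lemma card_configuration G : G \in configurations d -> #|half_edge d| = #|G| * 2.
Proof.
rewrite inE => /andP[part /forall_inP c2].
by rewrite -cardsT (card_uniform_partition (n := 2) _ part) // => e /c2/eqP.
Qed.

Lemma pair_neq G a b : G \in configurations d -> [set a; b] \in G -> a != b.
Proof. by case/configurationsP=> c2 _ _ /c2; rewrite cards2; case: eqP. Qed.

Lemma mate_uniq G a b c : G \in configurations d ->
  [set a; b] \in G -> [set a; c] \in G -> b = c.
Proof.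
move=> Gc abG acG; have /configurationsP[_ uniq _] := Gc.
have := uniq _ _ a abG acG (set21 _ _) (set21 _ _).
move/setP/(_ b); rewrite !inE eqxx orbT => /esym/orP[/eqP ba|/eqP //].
by have := pair_neq Gc abG; rewrite ba eqxx.
Qed.

Lemma set2_of_mem e a : #|e| = 2 -> a \in e -> exists2 b, a != b & e = [set a; b].
Proof.
move=> /eqP/cards2P[x [y [xy ->]]]; rewrite !inE => /orP[]/eqP->; first by exists y.
by exists x; [rewrite eq_sym | rewrite setUC].
Qed.

Lemma exists_mate G a : G \in configurations d -> exists b, [set a; b] \in G.
Proof.
move=> Gc; have /configurationsP[c2 _ cov] := Gc.
have [e eG ae] := cov a; have [b _ eE] := set2_of_mem (c2 e eG) ae.
by exists b; rewrite -eE.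
Qed.

Lemma card_mate G a : G \in configurations d -> #|[set b | [set a; b] \in G]| = 1.
Proof.
move=> Gc; have [b abG] := exists_mate a Gc.
apply/eqP/cards1P; exists b; apply/setP => c; rewrite !inE.
by apply/idP/eqP => [acG|->//]; exact: mate_uniq Gc acG abG.
Qed.

Lemma distinct_edges_disjoint G a b c (e : half_edge d) : G \in configurations d ->
  [set a; b] \in G -> [set c; e] \in G -> [set a; b] != [set c; e] ->
  [/\ a != c, a != e, b != c & b != e].
Proof.
move=> Gc abG ceG neq; have /configurationsP[_ uniq _] := Gc.
have dis x y : x \in [set a; b] -> y \in [set c; e] -> x != y.
  move=> xab yce; apply: contra neq => /eqP xy; rewrite -xy in yce.
  by apply/eqP; apply: uniq xab yce.
by split; apply: dis; rewrite !inE eqxx ?orbT.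
Qed.

(** * Switchings *)

(** Only the mates of the four half-edges of the two switched edges change. *)
Lemma switch_configuration G p q : G \in configurations d ->
  [set p.1; p.2] \in G -> [set q.1; q.2] \in G ->
  [set p.1; p.2] != [set q.1; q.2] -> switch G p q \in configurations d.
Proof.
case: p q => [a b] [c e] /= Gc abG ceG neq; have /configurationsP[c2 uniq cov] := Gc.
have ab := pair_neq Gc abG; have ce := pair_neq Gc ceG.
have [ac ae bc be] := distinct_edges_disjoint Gc abG ceG neq.
have old x f : f \in G -> f != [set a; b] -> f != [set c; e] -> x \in f ->
    [/\ x != a, x != b, x != c & x != e].
  move=> fG fab fce xf.
  split; apply/eqP => xE; rewrite {}xE in xf.
  - by case/eqP: fab; apply: uniq xf (set21 _ _).
  - by case/eqP: fab; apply: uniq xf (set22 _ _).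
  - by case/eqP: fce; apply: uniq xf (set21 _ _).
  - by case/eqP: fce; apply: uniq xf (set22 _ _).
apply/configurationsP; split.
- move=> f; rewrite !inE => /orP[/andP[_ /c2 //]|/orP[]/eqP->]; rewrite cards2 ?ae //.
  by rewrite eq_sym bc.
- move=> f g h; rewrite !inE !negb_or.
  move=> /orP[/andP[/andP[f1 f2] fG]|/orP[]/eqP->];
  move=> /orP[/andP[/andP[g1 g2] gG]|/orP[]/eqP->] => //; rewrite ?inE.
  + by move=> hf hg; apply: uniq hf hg.
  + move=> /(old _ _ fG f1 f2) [/negPf ha /negPf hb /negPf hc /negPf he].
    by rewrite ha he.
  + move=> /(old _ _ fG f1 f2) [/negPf ha /negPf hb /negPf hc /negPf he].
    by rewrite hb hc.
  + move=> hf /(old _ _ gG g1 g2) [/negPf ha /negPf hb /negPf hc /negPf he].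
    by move: hf; rewrite ha he.
  + move=> /orP[]/eqP ->; first by rewrite (negPf ac) (negPf ab).
    by rewrite eq_sym (negPf ce) eq_sym (negPf be).
  + move=> hf /(old _ _ gG g1 g2) [/negPf ha /negPf hb /negPf hc /negPf he].
    by move: hf; rewrite hb hc.
  + move=> /orP[]/eqP ->; first by rewrite eq_sym (negPf ac) (negPf ce).
    by rewrite eq_sym (negPf ab) (negPf be).
- move=> h; have [f fG hf] := cov h.
  have [fab|fab] := eqVneq f [set a; b].
    move: hf; rewrite fab !inE => /orP[]/eqP ->.
      by exists [set a; e]; rewrite !inE !eqxx ?orbT.
    by exists [set c; b]; rewrite !inE !eqxx ?orbT.
  have [fce|fce] := eqVneq f [set c; e].
    move: hf; rewrite fce !inE => /orP[]/eqP ->.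
      by exists [set c; b]; rewrite !inE !eqxx ?orbT.
    by exists [set a; e]; rewrite !inE !eqxx ?orbT.
  by exists f => //; rewrite !inE fG (negPf fab) (negPf fce).
Qed.

Lemma endpoints2 a b : endpoints [set a; b] = [set tag a; tag b].
Proof. by rewrite /endpoints imsetU1 imset_set1. Qed.

Lemma card_orderings a b :
  #|[set q : half_edge d * half_edge d | [set q.1; q.2] == [set a; b]]| <= 2.
Proof.
apply: leq_trans (_ : #|[set (a, b); (b, a)]| <= _); last first.
  by rewrite cards2; case: (_ != _).
apply: subset_leq_card; apply/subsetP => -[x y]; rewrite !inE /= !xpair_eqE.
by move=> /eqP/pair_set_eq[][-> ->]; rewrite !eqxx ?orbT.
Qed.

(** An ordered pair of matched half-edges is determined by its first member. *)
Lemma sum_edges_left G (P : pred (half_edge d)) : G \in configurations d ->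
  \sum_(q : half_edge d * half_edge d | P q.1 && ([set q.1; q.2] \in G)) 1 = #|P|.
Proof.
move=> Gc.
rewrite -(pair_big_dep P (fun a b => [set a; b] \in G) (fun _ _ => 1)) /=.
rewrite -sum1_card; apply: eq_bigr => a _.
by rewrite sum1dep_card card_mate.
Qed.

Lemma sum_edges_right G (P : pred (half_edge d)) : G \in configurations d ->
  \sum_(q : half_edge d * half_edge d | P q.2 && ([set q.1; q.2] \in G)) 1 = #|P|.
Proof.
move=> Gc; rewrite -(sum_edges_left P Gc).
rewrite (reindex_inj (inv_inj (@swap_pairK _ _))) /=.
by apply: eq_bigl => -[a b] /=; rewrite setUC.
Qed.

(** * The weight of a configuration *)

(** Each edge is counted in both orientations, which makes the weight equal to
    the sum of [d i * neighbour_degrees G i] over the vertices [i]. *)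
Definition weight G :=
  \sum_(q : half_edge d * half_edge d | [set q.1; q.2] \in G)
     d (tag q.1) * d (tag q.2).

Definition neighbour_degrees G (i : 'I_n) :=
  \sum_(q : half_edge d * half_edge d | (tag q.1 == i) && ([set q.1; q.2] \in G))
     d (tag q.2).

Definition adjacent G (i j : 'I_n) := [exists e in G, endpoints e == [set i; j]].

Lemma card_half_edge_adjacent G i : G \in configurations d ->
  #|[pred h : half_edge d | adjacent G i (tag h)]| <= neighbour_degrees G i.
Proof.
move=> Gc; have /configurationsP[c2 _ _] := Gc.
rewrite /neighbour_degrees.
under eq_bigr => q _ do rewrite -card_half_edge_at -sum1dep_card.
rewrite (exchange_big_dep xpredT) //= -sum1_card big_mkcond.
apply: leq_sum => h _; case: ifPn => // /exists_inP[e eG /eqP eE].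
have /eqP/cards2P[a [b [_ eab]]] := c2 e eG.
move: eE; rewrite eab endpoints2 => /pair_set_eq[][ta tb].
  by rewrite (bigD1 (a, b)) //= -eab eG ta tb !eqxx.
by rewrite (bigD1 (b, a)) //= setUC -eab eG ta tb !eqxx.
Qed.

(** The degree of [i] cancels between the two bounds
    [neighbour_degrees G i <= m * d i] and [d i * neighbour_degrees G i <= weight G],
    so the estimate is uniform in the vertex. *)
Lemma neighbour_degrees_sqr G i m : (forall i, d i <= m) -> G \in configurations d ->
  neighbour_degrees G i ^ 2 <= m * weight G.
Proof.
move=> dm Gc.
have le_md : neighbour_degrees G i <= m * d i.
  rewrite -(card_half_edge_at i) cardsE -(sum_edges_left _ Gc) mulnC big_distrl /=.
  by apply: leq_sum => q _; rewrite mul1n.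
have le_w : d i * neighbour_degrees G i <= weight G.
  rewrite /neighbour_degrees /weight big_distrr /=.
  rewrite [leqLHS]big_mkcond [leqRHS]big_mkcond /=.
  by apply: leq_sum => q _; case: ifP => [/andP[/eqP <- ->] //|_]; case: ifP.
rewrite -mulnn; apply: leq_trans (leq_mul le_md (leqnn _)) _.
by rewrite -mulnA leq_mul2l le_w orbT.
Qed.

(** Two edges are added, each counted in two orientations with a product of
    degrees at most [m ^ 2]. *)
Lemma weight_switch G p q m : (forall i, d i <= m) ->
  weight (switch G p q) <= weight G + 4 * m ^ 2.
Proof.
move=> dm; pose on (e : {set half_edge d}) :=
  \sum_(r : half_edge d * half_edge d | [set r.1; r.2] == e)
    d (tag r.1) * d (tag r.2).
have on_le a b : on [set a; b] <= 2 * m ^ 2.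
  apply: leq_trans (_ : \sum_(r : half_edge d * half_edge d |
    [set r.1; r.2] == [set a; b]) m ^ 2 <= _).
    by apply: leq_sum => r _; rewrite -mulnn leq_mul.
  rewrite sum_nat_cond_const leq_mul2r; apply/orP; right.
  by have := card_orderings a b; rewrite cardsE.
pose new := on [set p.1; q.2] + on [set q.1; p.2].
apply: leq_trans (_ : weight G + new <= _); last first.
  rewrite leq_add2l; apply: leq_trans (leq_add (on_le _ _) (on_le _ _)) _.
  by rewrite -mulnDl.
apply: leq_trans (leq_add (leqnn _) (leq_sum_or _ _ _)).
apply: leq_trans (leq_sum_or _ _ _).
rewrite /weight [leqLHS]big_mkcond [leqRHS]big_mkcond /=.
apply: leq_sum => r _; rewrite !inE.
by case: (_ \in G); case: (_ == _); case: (_ == _); rewrite ?andbF ?andbT //=; case: ifP.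
Qed.

(** * When a switching creates a bad edge *)

(** A new bad edge involves an added edge: either an added edge is a loop, or
    the two added edges are parallel to each other (possible only if the
    switched edges share an end or the chosen one is a loop), or an added edge
    is parallel to an edge of [G]. *)
Lemma creates_bad_edge_switch G p q : creates_bad_edge G (switch G p q) ->
  [|| tag q.2 == tag p.1, tag q.1 == tag p.2, tag q.1 == tag p.1,
      tag q.1 == tag q.2, adjacent G (tag p.1) (tag q.2)
    | adjacent G (tag p.2) (tag q.1)].
Proof.
case: p q => [a b] [c e] /=; apply: contraLR; rewrite !negb_or.
move=> /and5P[ea cb ca ce /andP[adj1 adj2]].
have adjacentN f : f \in G ->
    (endpoints f != [set tag a; tag e]) && (endpoints f != [set tag c; tag b]).
  move=> fG; rewrite [X in _ && (_ != X)]setUC; apply/andP; split.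
    by apply: contra adj1 => /eqP fE; apply/exists_inP; exists f => //; rewrite fE.
  by apply: contra adj2 => /eqP fE; apply/exists_inP; exists f => //; rewrite fE.
have newN : [set tag a; tag e] != [set tag c; tag b].
  apply/eqP => /pair_set_eq[][aE eE]; first by rewrite aE eqxx in ca.
  by rewrite -eE eqxx in ce.
have par f g : f \in switch G (a, b) (c, e) -> g \in switch G (a, b) (c, e) ->
    parallel f g -> (f \in G) && (g \in G).
  rewrite /parallel !inE => /orP[/andP[_ fG]|/orP[]/eqP->];
    move=> /orP[/andP[_ gG]|/orP[]/eqP->];
    rewrite ?eqxx ?fG ?gG ?endpoints2 //= => /andP[_];
    rewrite ?(negPf newN) ?[_ == [set tag a; tag e]]eq_sym ?(negPf newN) //.
  - by case/andP: (adjacentN f fG) => /negPf; rewrite eq_sym => ->.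
  - by case/andP: (adjacentN f fG) => _ /negPf ->.
  - by case/andP: (adjacentN g gG) => /negPf; rewrite eq_sym => ->.
  - by case/andP: (adjacentN g gG) => _ /negPf; rewrite eq_sym => ->.
rewrite negbK; apply/subsetP => f; rewrite /bad_edges [_ \in [set _ in G | _]]inE inE.
move=> /andP[fG' /orP[fl|/exists_inP[g gG' fg]]]; last first.
  have /andP[fG gG] := par f g fG' gG' fg.
  by rewrite fG /=; apply/orP; right; apply/exists_inP; exists g.
rewrite fl andbT; move: fG' fl; rewrite !inE => /orP[/andP[_ ->] //|].
rewrite /is_loop => /orP[]/eqP ->; rewrite endpoints2 cards2.
  by rewrite (eq_sym (tag a)) ea.
by rewrite (negPf cb).
Qed.

(** The six terms bound the six cases of [creates_bad_edge_switch], in that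
    order.  A condition on one end of the chosen edge fixes that edge once the
    half-edge at this end is given; a loop is itself a bad edge and has two
    orientations. *)
Lemma card_creating_choices G p : G \in configurations d ->
  #|[set q | ([set q.1; q.2] \in G) && creates_bad_edge G (switch G p q)]| <=
    d (tag p.1) + d (tag p.2) + d (tag p.1) + 2 * #|bad_edges G| +
    neighbour_degrees G (tag p.1) + neighbour_degrees G (tag p.2).
Proof.
move=> Gc; pose N := [pred q : half_edge d * half_edge d | [set q.1; q.2] \in G].
have left P : #|[pred q | N q & P q.1]| = #|P|.
  rewrite -(sum_edges_left P Gc) sum1dep_card cardsE.
  by apply: eq_card => q; rewrite !inE andbC.
have right P : #|[pred q | N q & P q.2]| = #|P|.
  rewrite -(sum_edges_right P Gc) sum1dep_card cardsE.
  by apply: eq_card => q; rewrite !inE andbC.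
have loops : #|[pred q | N q & tag q.1 == tag q.2]| <= 2 * #|bad_edges G|.
  pose ends q := [set q.1; q.2].
  rewrite -[leqLHS]sum1_card (partition_big ends (mem (bad_edges G))) /=; last first.
    move=> q; rewrite !inE => /andP[-> /eqP qE].
    by rewrite /is_loop endpoints2 qE setUid cards1 eqxx.
  rewrite mulnC -sum_nat_const; apply: leq_sum => e; rewrite inE => /andP[eG _].
  have /configurationsP[c2 _ _] := Gc.
  have /eqP/cards2P[a [b [_ ->]]] := c2 e eG.
  rewrite sum1_card; apply: leq_trans (card_orderings a b).
  by apply: subset_leq_card; apply/subsetP => q; rewrite !inE => /andP[].
pose at_ i := [pred h : half_edge d | tag h == i].
have cat i : #|at_ i| = d i by rewrite -card_half_edge_at cardsE.
pose nb i := [pred h : half_edge d | adjacent G i (tag h)].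
rewrite -(cat (tag p.1)) -(cat (tag p.2)).
apply: leq_trans (leq_add (leq_add (leq_add (leqnn _) loops)
   (card_half_edge_adjacent (tag p.1) Gc)) (card_half_edge_adjacent (tag p.2) Gc)).
rewrite -{1}(right (at_ (tag p.1))) -(left (at_ (tag p.2))) -(left (at_ (tag p.1))).
rewrite -(right (nb (tag p.1))) -(left (nb (tag p.2))).
rewrite cardsE !card_sum_mem -!big_split /=.
apply: leq_sum => q _; rewrite !inE unfold_in; case: (_ \in G) => //=.
case: (boolP (creates_bad_edge _ _)) => // /creates_bad_edge_switch.
by case/or4P => [->|->|->|/or3P[]->] //=; rewrite ?addn1 ?addnS ?addSn.
Qed.

(** The switched edge was bad and has disappeared, while the bad edges that
    remain were bad before. *)
Lemma bad_edges_switch G p q : G \in configurations d ->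
  [set p.1; p.2] \in bad_edges G -> [set q.1; q.2] \in G ->
  [set p.1; p.2] != [set q.1; q.2] -> ~~ creates_bad_edge G (switch G p q) ->
  #|bad_edges (switch G p q)| < #|bad_edges G|.
Proof.
move=> Gc pbad qG pq; rewrite negbK => sub.
have pG : [set p.1; p.2] \in G by move: pbad; rewrite inE => /andP[].
have G'c := switch_configuration Gc pG qG pq.
have /configurationsP[_ uniq _] := Gc.
apply: proper_card; rewrite properE sub; apply/subsetPn.
exists [set p.1; p.2] => //; rewrite inE; apply/negP => /andP[pG' _].
have G'e : [set p.1; q.2] \in switch G p q by rewrite !inE eqxx orbT.
have p2 := mate_uniq G'c pG' G'e.
case/eqP: pq; apply: (uniq _ _ p.2) => //; rewrite ?set22 //.
by rewrite p2 set22.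
Qed.

End Configurations.

(** * First moments in the configuration model *)

Section FirstMoments.
Local Open Scope nat_scope.
Local Open Scope set_scope.
Variables (n : nat) (d : 'I_n -> nat).
Implicit Types (G F : edge_set d) (e f : {set half_edge d}) (h a b c : half_edge d).
Implicit Types q r : half_edge d * half_edge d.

(** The action of the permutations of half-edges on configurations.  It
    preserves the uniform law, which replaces an explicit count of the
    configurations. *)
Definition relabel (s : {perm half_edge d}) G : edge_set d :=
  [set s @: (e : {set half_edge d}) | e : {set half_edge d} in G].

Lemma relabel_inj s : injective (relabel s).
Proof. exact/imset_inj/imset_inj/perm_inj. Qed.

Lemma relabel_configuration s G :
  G \in configurations d -> relabel s G \in configurations d.
Proof.
case/configurationsP=> c2 uniq cov; apply/configurationsP; split.
- by move=> _ /imsetP[e eG ->]; rewrite (card_imset _ perm_inj) c2.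
- move=> _ _ h /imsetP[e eG ->] /imsetP[f fG ->] /imsetP[x xe ->].
  by rewrite (mem_imset _ _ perm_inj) => xf; rewrite (uniq e f x).
- move=> h; have [e eG he] := cov (s^-1 h)%g.
  exists (s @: e); first exact: imset_f.
  by apply/imsetP; exists (s^-1 h)%g => //; rewrite permKV.
Qed.

Definition count_extensions F := #|[set G in configurations d | F \subset G]|.

Lemma count_extensions_relabel s F :
  count_extensions F <= count_extensions (relabel s F).
Proof.
rewrite /count_extensions -(card_imset _ (@relabel_inj s)).
apply: subset_leq_card; apply/subsetP => _ /imsetP[G /setIdP[Gc FG] ->].
by apply/setIdP; rewrite relabel_configuration ?imsetS.
Qed.

Lemma imset_pair (s : {perm half_edge d}) a b : s @: [set a; b] = [set s a; s b].
Proof. by rewrite imsetU1 imset_set1. Qed.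

(** In every configuration [a] has exactly one mate [b]. *)
Lemma sum_count_extensions F a :
  \sum_b count_extensions ([set a; b] |: F) = count_extensions F.
Proof.
rewrite /count_extensions -sum1dep_card.
under eq_bigr => b _ do rewrite -sum1dep_card.
pose extends G := (G \in configurations d) && (F \subset G).
rewrite (exchange_big_dep extends) /=; last first.
  by move=> b G _ /andP[Gc]; rewrite /extends Gc subUset => /andP[].
apply: eq_bigr => G /andP[Gc FG]; rewrite sum1dep_card -(card_mate a Gc).
by apply: eq_card => b; rewrite [LHS]inE [RHS]inE Gc subUset sub1set FG andbT.
Qed.

(** A given pair is matched with probability at most 1 / (N - 1): by symmetry
    all the possible mates of [a] are equally likely. *)
Lemma count_extensions1 a b :
  count_extensions [set [set a; b]] * #|half_edge d|.-1 <= #|configurations d|.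
Proof.
have [->|ab] := eqVneq a b.
  rewrite (_ : count_extensions _ = 0) //; apply: eq_card0 => G.
  by apply/negP => /setIdP[Gc]; rewrite sub1set => /(pair_neq Gc); rewrite eqxx.
have -> : #|configurations d| = count_extensions finset.set0.
  by apply: eq_card => G; apply/idP/setIdP => [->|[]//]; rewrite sub0set.
rewrite -[leqRHS](sum_count_extensions _ a) mulnC -(cardC1 a) -sum_nat_const.
rewrite [leqRHS](bigID [in predC1 a]) /=; apply: leq_trans (leq_addr _ _).
apply: leq_sum => b'; rewrite inE => b'a.
apply: leq_trans (count_extensions_relabel (tperm b b') _) _.
by rewrite /relabel imset_set1 imset_pair tpermL tpermD ?setU0 // eq_sym.
Qed.

(** Once [a] and [b] are matched, the N - 3 half-edges other than [a], [b] and
    [c] are equally likely mates of [c].  Two distinct pairs that overlap never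
    occur together. *)
Lemma count_extensions2 a b c (e : half_edge d) : [set a; b] != [set c; e] ->
  count_extensions [set [set a; b]; [set c; e]] *
    (#|half_edge d|.-1 * (#|half_edge d| - 3)) <= #|configurations d|.
Proof.
move=> neq; set F := [set _; _].
(* If some configuration contains both pairs, they must be disjoint. *)
have [->//|] := posnP (count_extensions F).
case/card_gt0P=> G /setIdP[Gc]; rewrite subUset !sub1set => /andP[abG ceG].
have ab := pair_neq Gc abG; have ce := pair_neq Gc ceG.
have [ac ae bc be] := distinct_edges_disjoint Gc abG ceG neq.
apply: leq_trans (count_extensions1 a b).
rewrite mulnA mulnAC leq_mul2r; apply/orP; right.
have <- : #|~: [set a; b; c]| = #|half_edge d| - 3.
  by rewrite cardsCs setCK -setUA !cardsU1 cards1 !inE negb_or ab ac bc.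
rewrite mulnC -sum_nat_const -[leqRHS](sum_count_extensions _ c).
rewrite [leqRHS](bigID [in ~: [set a; b; c]]) /=; apply: leq_trans (leq_addr _ _).
apply: leq_sum => e'; rewrite !inE !negb_or => /andP[/andP[e'a e'b] e'c].
apply: leq_trans (count_extensions_relabel (tperm e e') _) _.
rewrite /relabel imsetU1 imset_set1 !imset_pair tpermL.
have fix_ x : x != e -> e' != x -> tperm e e' x = x.
  by move=> xe e'x; rewrite tpermD // eq_sym.
by rewrite !fix_ // setUC.
Qed.

Lemma sum_degrees : \sum_(h : half_edge d) d (tag h) = \sum_i d i ^ 2.
Proof.
rewrite (sum_half_edge d).
by apply: eq_bigr => i _; rewrite mulnn.
Qed.

Lemma sum_degree_products :
  \sum_(q : half_edge d * half_edge d) d (tag q.1) * d (tag q.2) = (\sum_i d i ^ 2) ^ 2.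
Proof.
rewrite -sum_degrees -mulnn big_distrl /=.
under [RHS]eq_bigr => h _ do rewrite big_distrr /=.
by rewrite pair_bigA.
Qed.

Lemma sum_weight_configurations :
  (\sum_(G in configurations d) weight G) * #|half_edge d|.-1 <=
    (\sum_i d i ^ 2) ^ 2 * #|configurations d|.
Proof.
rewrite -sum_degree_products /weight (exchange_big_dep xpredT) //= !big_distrl /=.
apply: leq_sum => q _; rewrite sum_nat_const mulnAC mulnC leq_mul2l; apply/orP; right.
apply: leq_trans (count_extensions1 q.1 q.2); rewrite leq_mul2r; apply/orP; right.
apply: subset_leq_card; apply/subsetP => G /andP[Gc qG].
by apply/setIdP; rewrite sub1set.
Qed.

(** A bad edge is a loop, or it can be oriented as [q] so that some other edge,
    oriented as [r], has the same ends in the same order. *)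
Lemma card_bad_edges G : G \in configurations d ->
  #|bad_edges G| <=
    \sum_(q : half_edge d * half_edge d | tag q.1 == tag q.2) ([set q.1; q.2] \in G) +
    \sum_(q : half_edge d * half_edge d)
      \sum_(r : half_edge d * half_edge d |
          (tag r.1 == tag q.1) && (tag r.2 == tag q.2))
        [&& [set q.1; q.2] != [set r.1; r.2],
            [set q.1; q.2] \in G & [set r.1; r.2] \in G].
Proof.
move=> Gc; have /configurationsP[c2 _ _] := Gc.
rewrite [X in _ <= X + _]big_mkcond -big_split /=.
pose ends q := [set q.1; q.2].
rewrite (partition_big ends xpredT) //= -sum1_card big_mkcond.
apply: leq_sum => e _; case: ifP => //; rewrite inE => /andP[eG].
have /eqP/cards2P[a [b [_ eE]]] := c2 e eG.
move=> /orP[|/exists_inP[f fG /andP[ef]]].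
  rewrite eE /is_loop endpoints2 cards2 => /eqP[]; case: eqP => // tab _.
  by rewrite (bigD1 (a, b)) /ends //= tab eqxx -eE eG.
have /eqP/cards2P[x [y [_ fE]]] := c2 f fG.
have par r : ends r = f -> tag r.1 = tag a -> tag r.2 = tag b -> 1 <=
  \sum_(q | ends q == e)
   ((if tag q.1 == tag q.2 then ([set q.1; q.2] \in G : nat) else 0) +
    \sum_(r : half_edge d * half_edge d |
          (tag r.1 == tag q.1) && (tag r.2 == tag q.2))
        [&& [set q.1; q.2] != [set r.1; r.2],
            [set q.1; q.2] \in G & [set r.1; r.2] \in G]).
  rewrite /ends => rf ra rb; rewrite (bigD1 (a, b)) /= ?eE ?eqxx //.
  rewrite (bigD1 r) /= ?ra ?rb ?eqxx //.
  by rewrite rf -eE ef eG fG !addn_gt0 /= orbT.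
move=> /eqP ends_ef.
have : [set tag a; tag b] = [set tag x; tag y] by rewrite -!endpoints2 -eE -fE.
case/pair_set_eq=> -[ta tb].
  by apply: (par (x, y)); rewrite //= /ends -fE.
by apply: (par (y, x)); rewrite //= /ends setUC -fE.
Qed.

(** There are M ordered pairs of half-edges with a common vertex, hence M^2 pairs
    of ordered pairs with the same ends in the same order. *)
Lemma sum_card_bad_edges :
  (\sum_(G in configurations d) #|bad_edges G|) *
     (#|half_edge d|.-1 * (#|half_edge d| - 3)) <=
    ((\sum_i d i ^ 2) * (#|half_edge d| - 3) + (\sum_i d i ^ 2) ^ 2) *
      #|configurations d|.
Proof.
refine (leq_trans (leq_mul (leq_sum _ (fun G => @card_bad_edges G)) (leqnn _)) _).
rewrite big_split /= mulnDl mulnDl; apply: leq_add.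
  rewrite mulnA [leqRHS]mulnAC leq_mul2r; apply/orP; right.
  have -> : \sum_i d i ^ 2 =
      \sum_(q : half_edge d * half_edge d | tag q.1 == tag q.2) 1.
    rewrite -sum_degrees.
    pose same_vertex a b := tag a == tag b.
    rewrite -(pair_big_dep xpredT same_vertex (fun _ _ => 1)) /=.
    apply: eq_bigr => a _; rewrite sum1dep_card -card_half_edge_at.
    by apply: eq_card => b; rewrite !inE eq_sym.
  rewrite exchange_big /= !big_distrl /=; apply: leq_sum => q _.
  rewrite mul1n; apply: leq_trans (count_extensions1 q.1 q.2).
  rewrite leq_mul2r /count_extensions -sum1dep_card big_mkcondr /=.
  by apply/orP; right; apply: leq_sum => G _; rewrite sub1set; case: (_ \in _).
rewrite -sum_degree_products exchange_big /= !big_distrl /=; apply: leq_sum => q _.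
rewrite -!card_half_edge_at -cardsX -sum1_card exchange_big /= !big_distrl /=.
rewrite (eq_bigl (fun r =>
  r \in setX [set h | tag h == tag q.1] [set h | tag h == tag q.2])); last first.
  by move=> r; rewrite !inE.
apply: leq_sum => r _; rewrite mul1n.
have [->|neq] := eqVneq [set q.1; q.2] [set r.1; r.2].
  by rewrite big1 ?mul0n.
apply: leq_trans (count_extensions2 neq).
rewrite leq_mul2r /count_extensions -sum1dep_card big_mkcondr /=.
apply/orP; right; apply: leq_sum => G _; rewrite subUset !sub1set.
by case: (_ \in _) => //=; case: (_ \in _).
Qed.

End FirstMoments.

From mathcomp Require Import all_classical all_reals all_analysis.
From mathcomp Require Import ring lra zify.
Import Order.TTheory GRing.Theory Num.Theory.
Import numFieldNormedType.Exports.
Local Open Scope classical_set_scope.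
Local Open Scope ring_scope.

(** * Finite-valued random variables *)

Section FiniteValued.
Variables (R : realType) (disp : measure_display) (T : measurableType disp).
Variables (P : probability T R) (F : finType) (Z : T -> F).
Hypothesis mZ : forall z, measurable [set w | Z w = z].

Lemma finite_preimageE (Phi : pred F) :
  [set w | Phi (Z w)] =
    \bigcup_(z in [set` [seq z <- index_enum F | Phi z]]) [set w | Z w = z].
Proof.
apply/seteqP; split => [w /= Pw|w /= [z]].
  by exists (Z w) => //=; rewrite mem_filter Pw mem_index_enum.
by rewrite /= mem_filter => /andP[Pz _] ->.
Qed.

Lemma measurable_finite_preimage (Phi : pred F) : measurable [set w | Phi (Z w)].
Proof. by rewrite finite_preimageE; apply: fin_bigcup_measurable. Qed.

Lemma finite_preimage_prob (Phi : pred F) :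
  fine (P [set w | Phi (Z w)]) = \sum_(z | Phi z) fine (P [set w | Z w = z]).
Proof.
rewrite finite_preimageE measure_fin_bigcup //; last first.
  by move=> x y _ _ [w [/= <- <-]].
rewrite -fsbig_seq ?filter_uniq ?index_enum_uniq // big_filter.
by rewrite sum_fine // => z _; apply: fin_num_measure.
Qed.

End FiniteValued.

(** * One step of the switching process *)

Section Transition.
Variables (R : realType) (n : nat) (d : 'I_n -> nat).
Implicit Types (G : edge_set d) (p q : half_edge d * half_edge d).

(** The transitions that have positive probability under some rule. *)
Definition may_follow G G' : bool :=
  if has_bad_edge G && (1 < #|G|)%N
  then [exists p, exists q, [&& [set p.1; p.2]%SET \in bad_edges G,
          [set q.1; q.2]%SET \in G, [set p.1; p.2]%SET != [set q.1; q.2]%SET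
          & G' == switch G p q]]
  else G' == G.

Variables (choice : half_edge d * half_edge d -> R) (G : edge_set d).
Hypothesis choice_law : has_bad_edge G ->
  [/\ forall p, 0 <= choice p, \sum_p choice p = 1
    & forall p, choice p != 0 -> [set p.1; p.2]%SET \in bad_edges G].

Lemma transition_prob_neq0 G' : transition_prob choice G G' != 0 -> may_follow G G'.
Proof.
rewrite /transition_prob /may_follow; case: ifP => [/andP[hb _]|_]; last first.
  by rewrite pnatr_eq0 eqb0 negbK.
have [_ _ choice_bad] := choice_law hb.
apply: contra_neqT => /existsPn no; rewrite /switching_prob big1 // => p _.
have [->|cp] := eqVneq (choice p) 0; first by rewrite mul0r.
rewrite big1 ?mulr0 // => f; rewrite !inE => /andP[fp fG].
rewrite big1 ?mulr0 // => q /eqP qf; case: eqP => [sw|]; last by rewrite mulr0.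
have /existsPn/(_ q) := no p.
by rewrite choice_bad // qf fG eq_sym fp sw eqxx.
Qed.

Lemma may_follow_configuration G' :
  G \in configurations d -> may_follow G G' -> G' \in configurations d.
Proof.
move=> Gc; rewrite /may_follow; case: ifP => _; last by move=> /eqP ->.
case/existsP=> p /existsP[q /and4P[pbad qG pq /eqP ->]].
by apply: switch_configuration => //; move: pbad; rewrite inE => /andP[].
Qed.

(** The chosen edge is one of [#|G| - 1] = (N - 2) / 2 edges and has two
    orientations, so each of the harmful ordered pairs has probability
    1 / (N - 2), whichever bad edge is switched. *)
Lemma creation_prob (t : R) : G \in configurations d -> 0 <= t ->
  (forall p, #|[set q | ([set q.1; q.2] \in G) &&
     creates_bad_edge G (switch G p q)]%SET|%:R <= t) ->
  \sum_(G' | creates_bad_edge G G') transition_prob choice G G' <=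
    t / (#|half_edge d| - 2)%:R.
Proof.
move=> Gc t0 ht.
rewrite /transition_prob.
case: (boolP (has_bad_edge G && _)) => [/andP[hb _]|_]; last first.
  rewrite big1 ?divr_ge0 // => G' cr; have [E|//] := eqVneq G' G.
  by move: cr; rewrite E /creates_bad_edge subxx.
have [c0 c1 choice_bad] := choice_law hb.
rewrite /switching_prob exchange_big /= -[leRHS]mul1r -[X in _ <= X * _]c1 mulr_suml.
apply: ler_sum => p _; rewrite -mulr_sumr.
have [->|cp] := eqVneq (choice p) 0; first by rewrite !mul0r.
apply: ler_wpM2l => //.
have pG : [set p.1; p.2]%SET \in G by have := choice_bad p cp; rewrite inE => /andP[].
have cardD : #|(G :\ [set p.1; p.2])%SET| = (#|G| - 1)%N.
  by rewrite (cardsD1 [set p.1; p.2]%SET G) pG addKn.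
rewrite cardD (card_configuration Gc).
have -> : t / (#|G| * 2 - 2)%:R = (#|G| - 1)%:R^-1 * (2^-1 * t).
  have -> : (#|G| * 2 - 2 = (#|G| - 1) * 2)%N by lia.
  by rewrite natrM invfM mulrC mulrA.
have -> : \sum_(G' | creates_bad_edge G G')
    \sum_(f in (G :\ [set p.1; p.2])%SET) (#|G| - 1)%:R^-1 *
      \sum_(q | [set q.1; q.2]%SET == f) 2^-1 * (switch G p q == G')%:R =
    (#|G| - 1)%:R^-1 * (2^-1 * \sum_(f in (G :\ [set p.1; p.2])%SET)
      \sum_(q | [set q.1; q.2]%SET == f) (creates_bad_edge G (switch G p q))%:R) :> R.
  rewrite exchange_big /= !mulr_sumr; apply: eq_bigr => f _.
  rewrite -mulr_sumr; congr (_ * _).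
  rewrite exchange_big /= mulr_sumr; apply: eq_bigr => q _.
  rewrite -mulr_sumr; congr (_ * _); rewrite big_mkcond /=.
  rewrite (bigD1 (switch G p q)) //= eqxx big1 ?addr0; first by case: ifP.
  by move=> G'; rewrite eq_sym => /negPf ->; rewrite if_same.
rewrite ler_wpM2l ?invr_ge0 // ler_wpM2l ?invr_ge0 //.
apply: le_trans (ht p).
rewrite -sum1_card natr_sum.
pose ends q : {set half_edge d} := [set q.1; q.2]%SET.
rewrite (partition_big ends (mem G)) /=; last first.
  by move=> q; rewrite inE => /andP[].
rewrite [leRHS](bigD1 [set p.1; p.2]%SET) //= -[leLHS]add0r lerD ?sumr_ge0 //.
rewrite (eq_bigl (fun f => (f \in G) && (f != [set p.1; p.2]%SET))); last first.
  by move=> f; rewrite !inE andbC.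
apply: ler_sum => f /andP[fG _].
rewrite big_mkcond [leRHS]big_mkcond; apply: ler_sum => q _.
rewrite inE; case: eqP => [->|]; last by rewrite andbF.
by rewrite fG andbT /=; case: creates_bad_edge.
Qed.

End Transition.

(** * The law of the switching process *)

Section Process.
Variables (R : realType) (n : nat) (d : 'I_n -> nat).
Variables (disp : measure_display) (T : measurableType disp).
Variables (P : probability T R).
Variable rule : seq (edge_set d) -> half_edge d * half_edge d -> R.
Variable Gamma : nat -> T -> edge_set d.
Hypothesis rule_ok : bad_edge_rule rule.
Hypothesis proc : switching_process P rule Gamma.
Implicit Types (G : edge_set d) (s : seq (edge_set d)) (w : T).

Let pr (A : set T) : R := fine (P A).

Lemma history_rcons s G :
  history Gamma (rcons s G) = history Gamma s `&` [set w | Gamma (size s) w = G].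
Proof.
apply/seteqP; split=> w; rewrite /history /= size_rcons mkseqS.
  by move=> /rcons_inj[-> ->].
by move=> [-> ->].
Qed.

Lemma measurable_history s : measurable (history Gamma s).
Proof.
elim/last_ind: s => [|s G IH].
  by rewrite (_ : history _ _ = setT) //; apply/seteqP; split.
rewrite history_rcons; apply: measurableI => //.
exact: (switching_process_measurable proc).
Qed.

Lemma pr_history_rcons s G G' :
  pr (history Gamma (rcons (rcons s G) G')) =
    pr (history Gamma (rcons s G)) * transition_prob (rule (rcons s G)) G G'.
Proof.
rewrite /pr (switching_process_step proc) fineM //.
exact: fin_num_measure (measurable_history _).
Qed.

(** The rule is a probability law on bad edges only along sequences of
    configurations, so this induction has to go along the whole history: each
    step keeps the history within the configurations and thereby makes the rule
    meaningful at the next one. *)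
Lemma history_support s : pr (history Gamma s) != 0 ->
  {subset s <= configurations d} /\
  forall k, (k.+1 < size s)%N ->
    may_follow (nth finset.set0 s k) (nth finset.set0 s k.+1).
Proof.
elim/last_ind: s => [//|s G IH].
case/lastP: s IH => [_|s H IH].
  have -> : history Gamma (rcons [::] G) = [set w | Gamma 0%N w = G].
    by apply/seteqP; split=> w; rewrite /history /=; [case | move=> <-].
  rewrite /pr (switching_process_start proc) /=.
  case: (boolP (G \in configurations d)) => [Gc _|]; last by rewrite mul0r eqxx.
  by split=> // G'; rewrite inE => /eqP ->.
rewrite pr_history_rcons mulf_eq0 negb_or => /andP[/IH{IH}[sc sf] tr].
have Hc : H \in configurations d by apply: sc; rewrite mem_rcons mem_head.
have law : has_bad_edge H -> _ := fun hb => rule_ok sc hb.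
have step := transition_prob_neq0 law tr.
split.
  move=> F; rewrite mem_rcons inE => /orP[/eqP->|/sc //].
  exact: may_follow_configuration Hc step.
move=> k; rewrite size_rcons ltnS leq_eqVlt => /orP[/eqP[kE]|lt_k].
  rewrite size_rcons in kE; case: kE => ->.
  by rewrite !nth_rcons !size_rcons ltnS leqnn !ltnn !eqxx.
by rewrite !(nth_rcons _ (rcons s H)) lt_k (ltnW lt_k); apply: sf.
Qed.

Definition history_tuple k w : k.-tuple (edge_set d) :=
  @Tuple k _ (mkseq (fun j => Gamma j w) k) (introT eqP (size_mkseq _ _)).

Lemma history_tupleE k (z : k.-tuple (edge_set d)) :
  [set w | history_tuple k w = z] = history Gamma z.
Proof.
apply/seteqP; split=> w; rewrite /history /= size_tuple; first by move=> <-.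
by move=> E; apply: val_inj.
Qed.

Lemma measurable_Gamma k (Phi : pred (edge_set d)) : measurable [set w | Phi (Gamma k w)].
Proof. exact: (measurable_finite_preimage (switching_process_measurable proc k)). Qed.

Lemma measurable_history_tuple k (Phi : pred (k.-tuple (edge_set d))) :
  measurable [set w | Phi (history_tuple k w)].
Proof.
apply: measurable_finite_preimage => z; rewrite history_tupleE.
exact: measurable_history.
Qed.

(** Outside this null event the first [k] configurations can be treated as a
    deterministic run of switchings. *)
Definition impossible_history k : set T :=
  [set w | pr (history Gamma (history_tuple k w)) == 0].

Lemma pr_impossible_history k : pr (impossible_history k) = 0.
Proof.
rewrite /pr (finite_preimage_prob _ (Z := history_tuple k) _
  (fun z => pr (history Gamma z) == 0)).
  by rewrite big1 // => z /eqP; rewrite /pr history_tupleE.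
by move=> z; rewrite history_tupleE; exact: measurable_history.
Qed.

Lemma possible_history k w : ~ impossible_history k w ->
  (forall j, (j < k)%N -> Gamma j w \in configurations d) /\
  (forall j, (j.+1 < k)%N -> may_follow (Gamma j w) (Gamma j.+1 w)).
Proof.
move=> /negP/history_support; rewrite /= size_mkseq => -[sub step]; split=> j jk.
  by apply: sub; apply/mapP; exists j; rewrite ?mem_iota.
by have := step j jk; rewrite !nth_mkseq // ltnW.
Qed.

(** The bound on one transition holds conditionally on every history of positive
    probability; averaging over the histories keeps it. *)
Lemma pr_creation (good : pred (edge_set d)) (t : R) k : 0 <= t ->
  (forall G p, G \in configurations d -> good G ->
     #|[set q | ([set q.1; q.2] \in G) &&
        creates_bad_edge G (switch G p q)]%SET|%:R <= t) ->
  pr [set w | good (Gamma k w) && creates_bad_edge (Gamma k w) (Gamma k.+1 w)] <=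
    t / (#|half_edge d| - 2)%:R.
Proof.
move=> t0 ht.
pose Z w := (history_tuple k w, Gamma k w, Gamma k.+1 w).
pose Y w := (history_tuple k w, Gamma k w).
have YE z : [set w | Y w = z] = history Gamma (rcons z.1 z.2).
  rewrite history_rcons -history_tupleE size_tuple.
  apply/seteqP; split=> w /=; first by move=> <-.
  by case: z => z1 z2 /= [Ez1 Ez2]; rewrite /Y Ez1 Ez2.
have ZE z : [set w | Z w = z] = history Gamma (rcons (rcons z.1.1 z.1.2) z.2).
  rewrite history_rcons -YE size_rcons size_tuple.
  apply/seteqP; split=> w /=; first by move=> <-.
  by case: z => z1 z2 /= [Ez1 Ez2]; rewrite /Z -/(Y w) Ez1 Ez2.
have mZ z : measurable [set w | Z w = z] by rewrite ZE; exact: measurable_history.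
have mY z : measurable [set w | Y w = z] by rewrite YE; exact: measurable_history.
rewrite /pr (finite_preimage_prob P mZ
  (fun z => good z.1.2 && creates_bad_edge z.1.2 z.2)).
under eq_bigr => z _ do rewrite ZE -/(pr _) pr_history_rcons.
rewrite -(pair_big_dep (fun z : k.-tuple (edge_set d) * edge_set d => good z.2)
  (fun z G' => creates_bad_edge z.2 G')
  (fun z G' => pr (history Gamma (rcons z.1 z.2)) *
     transition_prob (rule (rcons z.1 z.2)) z.2 G')) /=.
have -> : t / (#|half_edge d| - 2)%:R =
    \sum_(z : k.-tuple (edge_set d) * edge_set d)
      pr [set w | Y w = z] * (t / (#|half_edge d| - 2)%:R).
  rewrite -mulr_suml -(finite_preimage_prob P mY xpredT).
  by rewrite (_ : [set w | _] = setT) ?probability_setT ?mul1r //; apply/seteqP; split.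
rewrite big_mkcond; apply: ler_sum => -[z G] _ /=.
have pr0 : 0 <= pr [set w | Y w = (z, G)] by rewrite fine_ge0.
case: ifP => [gG|_]; last by rewrite mulr_ge0 // divr_ge0.
rewrite -mulr_sumr YE /=.
have [->|nz] := eqVneq (pr (history Gamma (rcons z G))) 0; first by rewrite !mul0r.
have [sub _] := history_support nz.
rewrite ler_wpM2l //; first by rewrite fine_ge0.
apply: creation_prob => //.
- by move=> hb; apply: rule_ok.
- by apply: sub; rewrite mem_rcons mem_head.
- by move=> p; apply: ht => //; apply: sub; rewrite mem_rcons mem_head.
Qed.

Lemma lt_switching_time (K : nat) w :
  ((K%:R)%:E < switching_time R Gamma w)%E <->
  forall j, (j <= K)%N -> has_bad_edge (Gamma j w).
Proof.
split=> [lt j jK|bad].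
  have [//|nb] := boolP (has_bad_edge (Gamma j w)).
  suff: (switching_time R Gamma w <= (K%:R)%:E)%E by rewrite leNgt lt.
  apply: (@le_trans _ _ (j%:R)%:E); last by rewrite lee_fin ler_nat.
  by apply: ereal_inf_lbound; exists j.
apply: (@lt_le_trans _ _ (K.+1%:R)%:E); first by rewrite lte_fin ltr_nat.
apply: le_ereal_inf_tmp => _ [j /= nb <-]; rewrite lee_fin ler_nat ltnNge.
by apply: contra nb => /bad.
Qed.

End Process.

(** * The process until its first creation of a bad edge *)

Section Run.
Variables (n : nat) (d : 'I_n -> nat).

Definition controlled (K W : nat) (G : edge_set d) : bool :=
  (#|bad_edges G| <= K)%N && (weight G <= W)%N.

Lemma may_follow_switch (G G' : edge_set d) :
  G \in configurations d -> (2 < #|half_edge d|)%N -> has_bad_edge G ->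
  may_follow G G' -> exists p q, [/\ [set p.1; p.2]%SET \in bad_edges G,
    [set q.1; q.2]%SET \in G, [set p.1; p.2]%SET != [set q.1; q.2]%SET
    & G' = switch G p q].
Proof.
move=> Gc; rewrite (card_configuration Gc) /may_follow => G2 ->.
have -> : (1 < #|G|)%N by move: G2; lia.
by case/existsP=> p /existsP[q /and4P[? ? ? /eqP ?]]; exists p, q.
Qed.

(** Before the first creation the number of bad edges decreases at each step and
    the weight increases by at most [4 * m ^ 2].  With at most [K] bad edges at
    the start there are at most [K] steps, so the run stays controlled, and the
    assumption that no controlled configuration is followed by a creation can be
    applied again at each step. *)
Lemma run_without_creation (m K L : nat) (Gamma : nat -> edge_set d) :
  (forall i, d i <= m)%N -> (2 < #|half_edge d|)%N ->
  (forall j, (j < K.+1)%N -> Gamma j \in configurations d) ->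
  (forall j, (j.+1 < K.+1)%N -> may_follow (Gamma j) (Gamma j.+1)) ->
  controlled K L (Gamma 0%N) ->
  (forall j, (j < K)%N -> controlled K (L + K * (4 * m ^ 2)) (Gamma j) ->
     ~~ creates_bad_edge (Gamma j) (Gamma j.+1)) ->
  forall k, (k <= K)%N -> (forall j, (j < k)%N -> has_bad_edge (Gamma j)) ->
  [/\ (#|bad_edges (Gamma k)| + k <= K)%N,
      (weight (Gamma k) <= L + k * (4 * m ^ 2))%N
    & forall j, (j < k)%N -> ~~ creates_bad_edge (Gamma j) (Gamma j.+1)].
Proof.
move=> dm N2 conf step /andP[bad0 weight0] nocr; elim=> [|k IH] kK hb.
  by split=> //; rewrite ?addn0 ?mul0n.
have [bk wk ck] := IH (ltnW kK) (fun j jk => hb j (ltnW jk)).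
have kK1 : (k < K.+1)%N by lia.
have [p [q [pbad qG pq E]]] :=
  may_follow_switch (conf k kK1) N2 (hb k (ltnSn k)) (step k kK).
have crk : ~~ creates_bad_edge (Gamma k) (Gamma k.+1).
  apply: nocr => //; apply/andP; split; first by lia.
  by apply: leq_trans wk _; rewrite leq_add2l leq_mul2r ltnW ?orbT.
split.
- have := crk; rewrite E => /(bad_edges_switch (conf k kK1) pbad qG pq); lia.
- rewrite E; apply: leq_trans (weight_switch _ _ _ dm) _.
  by rewrite -(addn1 k) mulnDl mul1n addnA leq_add2r.
- by move=> j; rewrite ltnS leq_eqVlt => /orP[/eqP->|/ck].
Qed.

Lemma card_creating_choices_controlled (R : realType) (m K W : nat) (r : R) (G : edge_set d) p :
  (forall i, d i <= m)%N -> 0 <= r -> (m * W)%:R <= r ^+ 2 ->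
  G \in configurations d -> controlled K W G ->
  #|[set q | ([set q.1; q.2] \in G) && creates_bad_edge G (switch G p q)]%SET|%:R <=
    (3 * m + 2 * K)%:R + 2 * r.
Proof.
move=> dm r0 hr Gc /andP[bK wW].
have nb i : (neighbour_degrees G i)%:R <= r.
  rewrite -(ler_pXn2r (n := 2)) ?nnegrE ?ler0n // -natrX; apply: le_trans hr.
  rewrite ler_nat; apply: leq_trans (neighbour_degrees_sqr _ dm Gc) _.
  by rewrite leq_mul2l wW orbT.
apply: (@le_trans _ _ ((3 * m + 2 * K)%:R + (neighbour_degrees G (tag p.1))%:R +
   (neighbour_degrees G (tag p.2))%:R)); last first.
  by have := nb (tag p.1); have := nb (tag p.2); lra.
rewrite -!natrD ler_nat; apply: leq_trans (card_creating_choices p Gc) _.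
rewrite !leq_add2r; have := dm (tag p.1); have := dm (tag p.2); lia.
Qed.

End Run.

(** * A bound for a fixed degree sequence *)

Section Bound.
Variables (R : realType) (n : nat) (d : 'I_n -> nat).
Variables (disp : measure_display) (T : measurableType disp).
Variables (P : probability T R).
Variable rule : seq (edge_set d) -> half_edge d * half_edge d -> R.
Variable Gamma : nat -> T -> edge_set d.
Hypothesis rule_ok : bad_edge_rule rule.
Hypothesis proc : switching_process P rule Gamma.

Let pr (A : set T) : R := fine (P A).

Lemma pr_mono (A B : set T) : measurable A -> measurable B -> A `<=` B -> pr A <= pr B.
Proof.
move=> mA mB AB; apply: fine_le; rewrite ?fin_num_measure //.
by apply: le_measure => //; rewrite inE.
Qed.

Lemma pr_setU (A B : set T) : measurable A -> measurable B ->
  pr (A `|` B) <= pr A + pr B.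
Proof.
move=> mA mB; rewrite -fineD ?fin_num_measure //; apply: fine_le.
- by apply: fin_num_measure; apply: measurableU.
- by rewrite fin_numD !fin_num_measure.
- exact: measureU2.
Qed.

Lemma pr_bigsetU (A : nat -> set T) K : (forall k, measurable (A k)) ->
  pr (\big[setU/set0]_(k < K) A k) <= \sum_(k < K) pr (A k).
Proof.
move=> mA; elim: K => [|K IH]; first by rewrite !big_ord0 /pr measure0.
rewrite !big_ord_recr /=; apply: le_trans (pr_setU _ _) _ => //.
  exact: bigsetU_measurable.
by rewrite lerD2r.
Qed.

Lemma pr_start (Phi : pred (edge_set d)) :
  pr [set w | Phi (Gamma 0%N w)] =
    #|[set G in configurations d | Phi G]%SET|%:R / #|configurations d|%:R.
Proof.
rewrite /pr (finite_preimage_prob P (switching_process_measurable proc 0%N)).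
under eq_bigr => G _ do rewrite (switching_process_start proc) /=.
rewrite -mulr_suml -natr_sum; congr (_%:R / _).
rewrite -sum1_card [LHS]big_mkcond [RHS]big_mkcond /=; apply: eq_bigr => G _.
by rewrite !inE; case: (_ && _) => //=; case: ifP.
Qed.

Lemma pr_start_markov (f : edge_set d -> nat) (A c K : nat) : (0 < c)%N ->
  ((\sum_(G in configurations d) f G) * c <= A * #|configurations d|)%N ->
  pr [set w | (K < f (Gamma 0%N w))%N] <= A%:R / (c * K.+1)%:R.
Proof.
move=> c0 hA; rewrite (pr_start (fun G => (K < f G)%N)).
have [->|conf0] := posnP #|configurations d|.
  by rewrite invr0 mulr0 divr_ge0.
rewrite ler_pdivrMr ?ltr0n // mulrAC ler_pdivlMr ?ltr0n ?muln_gt0 ?c0 //.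
rewrite -!natrM ler_nat mulnA mulnAC; apply: leq_trans hA.
by rewrite leq_mul2r markov_nat orbT.
Qed.

Lemma measurable_has_bad_edges K :
  measurable [set w | forall j, (j <= K)%N -> has_bad_edge (Gamma j w)].
Proof.
rewrite (_ : [set w | _] =
  \bigcap_(j in [set j | (j <= K)%N]) [set w | has_bad_edge (Gamma j w)]) //.
by apply: bigcap_measurableType => j _; exact: (measurable_Gamma proc).
Qed.

Lemma measurable_switching_time_gt (K : nat) :
  measurable [set w | ((K%:R)%:E < switching_time R Gamma w)%E].
Proof.
rewrite (_ : [set w | _] = [set w | forall j, (j <= K)%N -> has_bad_edge (Gamma j w)]).
  exact: measurable_has_bad_edges.
by apply/seteqP; split=> w /= /(lt_switching_time R).
Qed.

Lemma measurable_Gamma_pair (Phi : rel (edge_set d)) k :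
  measurable [set w | Phi (Gamma k w) (Gamma k.+1 w)].
Proof.
pose Z w := (Gamma k w, Gamma k.+1 w).
apply: (measurable_finite_preimage (Z := Z) _ (fun z => Phi z.1 z.2)) => z.
rewrite (_ : [set w | _] = [set w | Gamma k w = z.1] `&` [set w | Gamma k.+1 w = z.2]).
  by apply: measurableI; exact: (switching_process_measurable proc).
apply/seteqP; split=> w /=; first by move=> <-.
by case: z => z1 z2 /= [<- <-].
Qed.

Lemma measurable_no_new_bad_edge : measurable (no_new_bad_edge R Gamma).
Proof.
rewrite (_ : no_new_bad_edge R Gamma = \bigcap_k
  (~` [set w | ((k%:R)%:E < switching_time R Gamma w)%E] `|`
   [set w | ~~ creates_bad_edge (Gamma k w) (Gamma k.+1 w)])).
  apply: bigcap_measurableType => k _; apply: measurableU.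
    by apply: measurableC; exact: measurable_switching_time_gt.
  exact: (measurable_Gamma_pair (fun G G' => ~~ creates_bad_edge G G')).
apply/seteqP; split=> w /= H k.
  move=> _; have [kS|] := pselect ((k%:R)%:E < switching_time R Gamma w)%E; last by left.
  by right; apply: H.
by move=> kS; have [] := H k I.
Qed.

(** The three terms are the probabilities, by Markov's inequality, that the
    initial configuration has more than [K] bad edges or weight more than [L],
    and a union bound over the first [K] steps for a creation from a
    configuration that is still controlled.  Outside these events there is no
    creation at all and the process stops within [K] steps. *)
Lemma exceptional_bound (m K L : nat) (r : R) :
  (forall i, d i <= m)%N -> (3 < #|half_edge d|)%N ->
  0 <= r -> (m * (L + K * (4 * m ^ 2)))%:R <= r ^+ 2 ->
  let N := #|half_edge d| in let M := (\sum_i d i ^ 2)%N in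
  let bound := (M * (N - 3) + M ^ 2)%:R / (N.-1 * (N - 3) * K.+1)%:R +
    (M ^ 2)%:R / (N.-1 * L.+1)%:R +
    K%:R * (((3 * m + 2 * K)%:R + 2 * r) / (N - 2)%:R) in
  pr (~` no_new_bad_edge R Gamma) <= bound /\
  pr [set w | ((K%:R)%:E < switching_time R Gamma w)%E] <= bound.
Proof.
move=> dm N3 r0 hr N M bound.
set W := (L + K * (4 * m ^ 2))%N in hr *.
pose E k := [set w | controlled K W (Gamma k w) &&
                      creates_bad_edge (Gamma k w) (Gamma k.+1 w)].
pose B1 := [set w | (K < #|bad_edges (Gamma 0%N w)|)%N].
pose B2 := [set w | (L < weight (Gamma 0%N w))%N].
pose B := (impossible_history P Gamma K.+1 `|` (B1 `|` B2)) `|`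
          \big[setU/set0]_(k < K) E k.
have mE k : measurable (E k).
  exact: (measurable_Gamma_pair (fun G G' => controlled K W G && creates_bad_edge G G')).
have mI : measurable (impossible_history P Gamma K.+1).
  exact: (measurable_history_tuple proc (fun z => pr (history Gamma z) == 0)).
have mB1 : measurable B1.
  exact: (measurable_Gamma proc 0%N (fun G => (K < #|bad_edges G|)%N)).
have mB2 : measurable B2.
  exact: (measurable_Gamma proc 0%N (fun G => (L < weight G)%N)).
have mB : measurable B.
  apply: measurableU; last exact: bigsetU_measurable.
  by apply: measurableU => //; exact: measurableU.
have prB : pr B <= bound.
  apply: le_trans (pr_setU _ _) _ => //.
  - by apply: measurableU => //; exact: measurableU.
  - exact: bigsetU_measurable.
  apply: lerD; last first.
    apply: le_trans (pr_bigsetU _ mE) _; rewrite mulr_natl -[K in _ *+ K]card_ord.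
    rewrite -sumr_const; apply: ler_sum => k _.
    apply: (pr_creation rule_ok proc); first by rewrite addr_ge0 ?mulr_ge0.
    by move=> G p Gc; apply: card_creating_choices_controlled.
  apply: le_trans (pr_setU _ _) _ => //; first exact: measurableU.
  rewrite [pr (impossible_history _ _ _)](pr_impossible_history proc) add0r.
  apply: le_trans (pr_setU _ _) _ => //; apply: lerD.
    apply: (pr_start_markov (f := fun G => #|bad_edges G|)).
      by rewrite muln_gt0; apply/andP; split; lia.
    exact: sum_card_bad_edges.
  by apply: pr_start_markov; [lia | exact: sum_weight_configurations].
have outside w : ~ B w -> (forall k, (k <= K)%N ->
    (forall j, (j < k)%N -> has_bad_edge (Gamma j w)) ->
    (#|bad_edges (Gamma k w)| + k <= K)%N /\
    forall j, (j < k)%N -> ~~ creates_bad_edge (Gamma j w) (Gamma j.+1 w)).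
  move=> /not_orP[/not_orP[nI /not_orP[n1 n2]] nE] k kK hb.
  have [conf step] := possible_history rule_ok proc nI.
  have start : controlled K L (Gamma 0%N w).
    by rewrite /controlled; apply/andP; split; rewrite leqNgt; apply/negP.
  have quiet j : (j < K)%N -> controlled K W (Gamma j w) ->
      ~~ creates_bad_edge (Gamma j w) (Gamma j.+1 w).
    move=> jK cj; apply/negP => cr; apply: nE.
    by rewrite -bigcup_mkord; exists j => //; rewrite /E /= cj cr.
  by have [] := run_without_creation dm (ltnW N3) conf step start quiet kK hb.
have stops w : ~ B w -> ~ (forall j, (j <= K)%N -> has_bad_edge (Gamma j w)).
  move=> nB hb; have [] := outside w nB K (leqnn K) (fun j jK => hb j (ltnW jK)).
  (* After [K] steps without creation no bad edge is left. *)
  have := hb K (leqnn K); rewrite /has_bad_edge -cards_eq0; lia.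
split; apply: le_trans prB; apply: pr_mono => //.
- exact: measurableC measurable_no_new_bad_edge.
- move=> w; apply: contra_notP => nB k /(lt_switching_time R) hb.
  have kK : (k < K)%N.
    by rewrite ltnNge; apply/negP => Kk; apply: (stops w nB) => j jK; apply: hb; lia.
  by have [_] := outside w nB k.+1 kK hb; apply.
- exact: measurable_switching_time_gt.
- move=> w; apply: contraPP => nB; apply/negP; rewrite -leNgt leNgt.
  by apply/negP => /(lt_switching_time R); exact: stops.
Qed.

End Bound.

(** * Asymptotics *)

Section Asymptotics.
Variable R : realType.

Lemma max_sqr_le_sum n (d : 'I_n -> nat) :
  ((\max_i d i) ^ 2 <= \sum_i d i ^ 2)%N.
Proof.
have [n0|n0] := posnP #|'I_n|.
  rewrite big1 // => i; have := fintype0 i n0; by [].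
have [i ->] := bigop.eq_bigmax d n0.
by rewrite (bigD1 i) //= leq_addr.
Qed.

(** The bound of [exceptional_bound] for [L = A * n] and [r = delta * n]: the
    first two terms are small for large [K] and [A], uniformly in [n]; the third
    is small for [delta] small compared with [K]. *)
Lemma exceptional_bound_asymptotic (c C delta : R) (n N M m K A : nat) :
  0 < c -> 0 < C -> 0 <= delta -> (0 < n)%N -> (0 < A)%N -> (6 <= N)%N ->
  c * n%:R <= N%:R -> M%:R <= C * n%:R -> m%:R <= delta * n%:R ->
  K%:R <= delta * n%:R ->
  (M * (N - 3) + M ^ 2)%:R / (N.-1 * (N - 3) * K.+1)%:R +
    (M ^ 2)%:R / (N.-1 * (A * n).+1)%:R +
    K%:R * (((3 * m + 2 * K)%:R + 2 * (delta * n%:R)) / (N - 2)%:R) <=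
  (2 * (C / c) + 4 * (C / c) ^+ 2) / K.+1%:R + (2 * (C / c) * C) / A%:R +
    K%:R * delta * (14 / c).
Proof.
move=> c0 C0 delta0 n0 A0 N6 hN hM hm hK.
have n0' : 0 < n%:R :> R by rewrite ltr0n.
have x6 : 6 <= N%:R :> R by rewrite (ler_nat R 6).
have x0 : 0 < N%:R :> R by lra.
have kappa0 : 0 < C / c by rewrite divr_gt0.
have hM' : M%:R <= C / c * N%:R.
  apply: le_trans hM _; rewrite -mulrA ler_pM2l //.
  by rewrite mulrC ler_pdivlMr // mulrC.
have sub_ge k : (k <= 3)%N -> N%:R / 2 <= (N - k)%:R :> R.
  move=> k3; rewrite natrB; last exact: leq_trans k3 (leq_trans _ N6).
  have : k%:R <= 3 :> R by rewrite (ler_nat R _ 3).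
  by clear -x6; lra.
have a_ge : N%:R / 2 <= N.-1%:R :> R by rewrite -subn1 sub_ge.
have b_ge : N%:R / 2 <= (N - 3)%:R :> R by rewrite sub_ge.
have e_ge : N%:R / 2 <= (N - 2)%:R :> R by rewrite sub_ge.
have a0 : 0 < N.-1%:R :> R by lra.
have b0 : 0 < (N - 3)%:R :> R by lra.
have e0 : 0 < (N - 2)%:R :> R by lra.
have A0' : 0 < A%:R :> R by rewrite ltr0n.
have xa : N%:R / N.-1%:R <= 2 :> R by rewrite ler_pdivrMr //; lra.
have xb : N%:R / (N - 3)%:R <= 2 :> R by rewrite ler_pdivrMr //; lra.
have Ma : M%:R / N.-1%:R <= 2 * (C / c).
  apply: le_trans (_ : C / c * (N%:R / N.-1%:R) <= _).
    by rewrite mulrA ler_pM2r // invr_gt0.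
  by rewrite [leRHS]mulrC ler_pM2l.
have Mb : M%:R / (N - 3)%:R <= 2 * (C / c).
  apply: le_trans (_ : C / c * (N%:R / (N - 3)%:R) <= _).
    by rewrite mulrA ler_pM2r // invr_gt0.
  by rewrite [leRHS]mulrC ler_pM2l.
apply: lerD; first apply: lerD.
- rewrite (natrM _ (N.-1 * (N - 3))) invfM [leLHS]mulrA ler_pM2r ?invr_gt0 ?ltr0n //.
  rewrite natrD !natrM mulrDl -mulf_div divff ?gt_eqF // mulr1.
  apply: lerD => //; rewrite -mulf_div.
  apply: le_trans (ler_pM _ _ Ma Mb) _; rewrite ?divr_ge0 //.
  by rewrite le_eqVlt; apply/orP; left; apply/eqP; ring.
- have -> : (M ^ 2)%:R / (N.-1 * (A * n).+1)%:R =
      (M%:R / N.-1%:R) * (M%:R / (A * n).+1%:R) :> R.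
    by rewrite natrX natrM expr2 mulf_div.
  rewrite -[leRHS]mulrA; apply: ler_pM => //; rewrite ?divr_ge0 //.
  apply: le_trans (_ : M%:R / (A * n)%:R <= _).
    by rewrite ler_wpM2l // lef_pV2 ?posrE ?ltr0n ?muln_gt0 ?A0 // ler_nat.
  by rewrite natrM ler_pdivrMr ?mulr_gt0 // mulrA divfK ?gt_eqF.
(* The numerator is at most 3 delta n + 2 delta n + 2 delta n. *)
- rewrite -mulrA ler_wpM2l // ler_pdivrMr //.
  have -> : (3 * m + 2 * K)%:R = 3 * m%:R + 2 * K%:R :> R by rewrite natrD !natrM.
  apply: le_trans (_ : delta * (7 * n%:R) <= _); first by lra.
  rewrite -mulrA ler_wpM2l // ?mulr_ge0 //.
  rewrite -mulrA; have : n%:R <= c^-1 * N%:R by rewrite mulrC ler_pdivlMr // mulrC.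
  have : 0 < c^-1 by rewrite invr_gt0.
  nra.
Qed.

End Asymptotics.

(** The parameters are chosen one after the other: [K] from [eps], then the bound
    [A * n] on the initial weight, then [delta], and [n] last.  The largest
    degree is at most [eta * n] for large [n] because its square is at most
    [C * n]. *)
Lemma eventually_unlikely (R : realType) (d : forall n : nat, 'I_n -> nat)
  (disp : nat -> measure_display)
  (T : forall n : nat, measurableType (disp n))
  (P : forall n : nat, probability (T n) R)
  (rule : forall n : nat,
     seq (edge_set (d n)) -> half_edge (d n) * half_edge (d n) -> R)
  (Gamma : forall n : nat, nat -> T n -> edge_set (d n)) (c C : R) :
  0 < c -> 0 < C ->
  (\forall n \near \oo, c * n%:R <= (\sum_(i < n) d n i)%N%:R) ->
  (\forall n \near \oo, (\sum_(i < n) d n i ^ 2)%N%:R <= C * n%:R) ->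
  (forall n : nat, bad_edge_rule (rule n)) ->
  (forall n : nat, switching_process (P n) (rule n) (Gamma n)) ->
  forall eps : R, 0 < eps -> exists K0 : nat, forall K, (K0 <= K)%N ->
    \forall n \near \oo,
      fine (P n (~` no_new_bad_edge R (Gamma n))) <= eps /\
      fine (P n [set w | ((K%:R)%:E < switching_time R (Gamma n) w)%E]) <= eps.
Proof.
move=> c0 C0 hN hM rule_ok proc eps eps0.
pose D1 := 2 * (C / c) + 4 * (C / c) ^+ 2; pose D2 := 2 * (C / c) * C.
have cC0 : 0 < C / c by rewrite divr_gt0.
have D1_gt0 : 0 < D1.
  by apply: addr_gt0; apply: mulr_gt0 => //; exact: exprn_gt0.
have D2_gt0 : 0 < D2 by do 2![apply: mulr_gt0 => //].
have small D k : 0 < D -> (Num.bound (3 * D / eps) <= k)%N -> (0 < k)%N ->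
    D / k%:R <= eps / 3.
  move=> D_gt0 hk k0; rewrite ler_pdivrMr ?ltr0n //.
  have : 3 * D / eps <= k%:R.
    apply: le_trans (_ : (Num.bound (3 * D / eps))%:R <= _); last by rewrite ler_nat.
    by apply/ltW/archi_boundP; rewrite divr_ge0 ?mulr_ge0 // ltW.
  rewrite ler_pdivrMr //; move: (k%:R : R) => x; lra.
exists (Num.bound (3 * D1 / eps)) => K hK.
pose A := (Num.bound (3 * D2 / eps)).+1.
(* This makes [K * delta * (14 / c)] at most [eps / 3]. *)
pose delta : R := eps * c / (42 * K.+1%:R).
have delta0 : 0 < delta by rewrite divr_gt0 ?mulr_gt0.
have Kdelta : K%:R * delta * (14 / c) <= eps / 3.
  have -> : K%:R * delta * (14 / c) = (K%:R / K.+1%:R) * (eps / 3).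
    rewrite /delta; field; rewrite ?gt_eqF //.
  rewrite ler_piMl ?divr_ge0 ?(ltW eps0) // ler_pdivrMr ?ltr0n // mul1r ler_nat.
  exact: leqnSn.
(* [B * n] bounds the weight during [K] steps, and [eta * B <= delta ^+ 2] is what
   [exceptional_bound] asks for. *)
pose B : R := A%:R + 4 * K%:R * C.
have B0 : 0 < B by rewrite ltr_wpDr ?ltr0n // !mulr_ge0 // ltW.
pose eta := Num.min delta (delta ^+ 2 / B).
have eta0 : 0 < eta by rewrite lt_min delta0 divr_gt0 ?exprn_gt0.
near=> n.
have n0 : (0 < n)%N by near: n; exists 1%N.
have hNn : c * n%:R <= (\sum_(i < n) d n i)%N%:R by near: n.
have hMn : (\sum_(i < n) d n i ^ 2)%N%:R <= C * n%:R by near: n.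
have n_ge1 : 6 / c <= n%:R by near: n; exact: nbhs_infty_ger.
have n_ge2 : K%:R / delta <= n%:R by near: n; exact: nbhs_infty_ger.
have n_ge3 : C / eta ^+ 2 <= n%:R by near: n; exact: nbhs_infty_ger.
have n0' : 0 < n%:R :> R by rewrite ltr0n.
set N := (\sum_(i < n) d n i)%N in hNn.
set M := (\sum_(i < n) d n i ^ 2)%N in hMn.
pose m := (\max_(i < n) d n i)%N.
have N6 : (6 <= N)%N.
  by rewrite -(ler_nat R); apply: le_trans hNn; rewrite mulrC -ler_pdivrMr.
have K_le : K%:R <= delta * n%:R by rewrite mulrC -ler_pdivrMr.
have m2 : m%:R ^+ 2 <= C * n%:R.
  by apply: le_trans hMn; rewrite -natrX ler_nat max_sqr_le_sum.
have m_le : m%:R <= eta * n%:R.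
  rewrite -(ler_pXn2r (n := 2)) ?nnegrE ?mulr_ge0 ?(ltW eta0) //.
  apply: le_trans m2 _; rewrite exprMn expr2 mulrA ler_pM2r //.
  by rewrite -expr2 mulrC -ler_pdivrMr ?exprn_gt0.
have hr : (m * (A * n + K * (4 * m ^ 2)))%:R <= (delta * n%:R) ^+ 2.
  apply: le_trans (_ : (eta * n%:R) * (B * n%:R) <= _).
    rewrite natrM ler_pM //.
    have -> : (A * n + K * (4 * m ^ 2))%:R =
        A%:R * n%:R + 4 * K%:R * (m%:R ^+ 2) :> R.
      by rewrite natrD 3!natrM natrX mulrCA mulrA.
    rewrite /B [leRHS]mulrDl lerD2l -[leRHS]mulrA.
    by rewrite ler_wpM2l // mulr_ge0.
  rewrite mulrACA exprMn -expr2 ler_wpM2r ?exprn_ge0 //.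
  by rewrite -ler_pdivlMr // ge_min lexx orbT.
have m_le_delta : m%:R <= delta * n%:R.
  by apply: le_trans m_le _; rewrite ler_wpM2r // ge_min lexx.
have dm i : (d n i <= m)%N by exact: leq_bigmax.
have cardN : #|half_edge (d n)| = N := card_half_edge (d n).
have N3 : (3 < #|half_edge (d n)|)%N by rewrite cardN; exact: leq_trans N6.
have r0 : 0 <= delta * n%:R by rewrite mulr_ge0 // ltW.
have [] := exceptional_bound (rule_ok n) (proc n) dm N3 r0 hr.
rewrite cardN -/M => b1 b2.
have le_eps := exceptional_bound_asymptotic c0 C0 (ltW delta0) n0
  (ltn0Sn _ : 0 < A)%N N6 hNn hMn m_le_delta K_le.
have t1 := small D1 K.+1 D1_gt0 (leqW hK) isT.
have t2 := small D2 A D2_gt0 (leqnSn _) isT.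
have fin : D1 / K.+1%:R + D2 / A%:R + K%:R * delta * (14 / c) <= eps.
  by apply: le_trans (lerD (lerD t1 t2) Kdelta) _; lra.
by split; [apply: le_trans b1 _ | apply: le_trans b2 _]; apply: le_trans le_eps fin.
Unshelve. all: by end_near.
Qed.

Lemma limn_esup_le (R : realType) (u : (\bar R)^nat) (e : \bar R) :
  (\forall n \near \oo, (u n <= e)%E) -> (limn_esup u <= e)%E.
Proof.
move=> ue; apply: le_trans (_ : (ereal_sup (u @` [set n | (u n <= e)%E]) <= _)%E).
  by apply: ereal_inf_lbound; exists [set n | (u n <= e)%E].
by apply: ge_ereal_sup => _ [n /= un <-].
Qed.

Theorem theorem3p2 (R : realType) (d : forall n : nat, 'I_n -> nat)
  (disp : nat -> measure_display)
  (T : forall n : nat, measurableType (disp n))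
  (P : forall n : nat, probability (T n) R)
  (rule : forall n : nat,
     seq (edge_set (d n)) -> half_edge (d n) * half_edge (d n) -> R)
  (Gamma : forall n : nat, nat -> T n -> edge_set (d n)) :
  (forall n : nat, ~~ odd (\sum_(i < n) d n i)%N) ->
  (exists c C : R, [/\ 0 < c, 0 < C & \forall n \near \oo,
     c * n%:R <= (\sum_(i < n) d n i)%N%:R <= C * n%:R]) ->
  ((fun n : nat => (\sum_(i < n) d n i ^ 2)%N%:R : R) =O_\oo
     (fun n : nat => n%:R : R)) ->
  (forall n : nat, bad_edge_rule (rule n)) ->
  (forall n : nat, switching_process (P n) (rule n) (Gamma n)) ->
  (fun n : nat => P n (no_new_bad_edge R (Gamma n))) @ \oo --> 1%E /\
  (fun K : nat => limn_esup (fun n : nat =>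
     P n [set w | ((K%:R)%:E < switching_time R (Gamma n) w)%E])) @ \oo --> 0%E.
Proof.
move=> _ [c [C1 [c0 _ hN]]] /eqO_exP[C C0 hM] rule_ok proc.
have {C1}hN : \forall n \near \oo, c * n%:R <= (\sum_(i < n) d n i)%N%:R.
  by apply: filterS hN => n /andP[].
have {}hM : \forall n \near \oo, (\sum_(i < n) d n i ^ 2)%N%:R <= C * n%:R.
  by apply: filterS hM => n; rewrite !ger0_norm.
have unlikely := eventually_unlikely c0 C0 hN hM rule_ok proc.
have mS n K := measurable_switching_time_gt (proc n) K.
have mB n := measurable_no_new_bad_edge (proc n).
split.
  apply: cvg_EFin; first by apply: nearW => n; apply: fin_num_measure.
  apply/cvgrPdist_le => e e0; have [K0 /(_ K0 (leqnn _)) small] := unlikely e e0.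
  apply: filterS small => n [small _] /=.
  rewrite -[no_new_bad_edge _ _]setCK probability_setC; last exact: measurableC.
  rewrite fineB ?fin_num_measure //=; last exact: measurableC.
  by rewrite opprB addrCA subrr addr0 ger0_norm ?fine_ge0.
pose u K := limn_esup (fun n : nat =>
  P n [set w | ((K%:R)%:E < switching_time R (Gamma n) w)%E]).
have u0 K : (0 <= u K)%E.
  by apply: limf_esup_ge0 => // -[N _ /(_ N)]; exact.
have u_le e : 0 < e -> \forall K \near \oo, (u K <= e%:E)%E.
  move=> e0; have [K0 small] := unlikely e e0.
  exists K0 => // K /= /small{}small; apply: limn_esup_le.
  apply: filterS small => n [_ small].
  by rewrite -lee_fin fineK ?fin_num_measure in small.
have u_fin : \forall K \near \oo, u K \is a fin_num.
  apply: filterS (u_le 1 ltr01) => K uK.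
  by rewrite ge0_fin_numE // (le_lt_trans uK) ?ltry.
apply: cvg_EFin => //; apply/cvgrPdist_le => e e0.
apply: filterS2 u_fin (u_le e e0) => K uK_fin uK_le.
rewrite [_ - _]sub0r normrN ger0_norm; last by apply: fine_ge0; exact: u0.
by rewrite -lee_fin /= fineK.
Qed.
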